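(* There exists a Boolean algebra $\mathfrak B$ which is approximable but does not carry any strictly positive separable finitely additive measure.
   Context: A (finitely additive) measure on a Boolean algebra $\mathfrak B$ is a function $\mu:\mathfrak B\to[0,\infty)$ with $\mu(a\vee b)=\mu(a)+\mu(b)$ whenever $a\wedge b=0$; it is a probability if $\mu(1)=1$ and strictly positive if $\mu(a)>0$ for all $a\neq0$. $\mathfrak B$ is approximable if there is a sequence $\langle\mu_n:n<\omega\rangle$ of finitely additive probability measures on $\mathfrak B$ such that for every $a\in\mathfrak B\setminus\{0\}$ there is $n$ with $\mu_n(a)>1/2$. A strictly positive measure $\mu$ on $\mathfrak B$ is separable if the metric space $(\mathfrak B,d_\mu)$, where $d_\mu(a,b)=\mu(a\,\triangle\,b)$, has a countable dense subset. *)

(* Defs.v *)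
From Stdlib Require Import Reals.
From mathcomp Require Import all_boot all_order.
Set Implicit Arguments. Unset Strict Implicit. Unset Printing Implicit Defensive.

(* A Boolean algebra is a complemented distributive lattice with top and bottom:
   MathComp's [ctbDistrLatticeType d]. *)

Section BA.
Variables (d : Order.disp_t) (B : ctbDistrLatticeType d).

Local Open Scope R_scope.

Definition fa_measure (mu : B -> R) : Prop :=
  (forall a, 0 <= mu a) /\
  (forall a b : B, Order.meet a b = Order.bottom ->
     mu (Order.join a b) = mu a + mu b).

Definition fa_probability (mu : B -> R) : Prop :=
  fa_measure mu /\ mu Order.top = 1.

Definition strictly_positive (mu : B -> R) : Prop :=
  forall a : B, a <> Order.bottom -> 0 < mu a.

Definition approximable : Prop :=
  exists mus : nat -> B -> R,
    (forall n, fa_probability (mus n)) /\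
    (forall a : B, a <> Order.bottom -> exists n, / 2 < mus n a).

Definition symdiff (a b : B) : B :=
  Order.join (Order.diff a b) (Order.diff b a).

(* (B, d_mu) with d_mu(a,b) = mu(a Δ b) has a countable dense subset
   (B is nonempty, so such a subset can be enumerated by nat). *)
Definition separable_measure (mu : B -> R) : Prop :=
  exists D : nat -> B,
    forall (a : B) (eps : R), 0 < eps -> exists n, mu (symdiff a (D n)) < eps.

End BA.

(* Main.v *)
(** Points are colourings of the vertices [(i, k)], [i : nat -> bool], and only
    the residue of the colour modulo [2^(k+1)] matters at level [k]. The algebra
    is generated by the coordinates and by the sets [G_s] of colourings under
    which, for every [k], the two ends of the [k]-th pair of the sequence [s] get
    distinct residues.

    Non-separability: if countably many elements were dense for [mu], then, as
    each level has uncountably many vertices and finitely many residues, at each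
    level [k] some two vertices would have the same residue up to
    [mu]-measure [1/(k+1)]. Taking such a pair at every level gives an [s] with
    [mu G_s = 0] although [G_s] is nonempty.

    Approximability: colour the levels below [m] by a fixed colouring read off a
    finite table of finite binary strings, and the other levels uniformly and
    independently. Then [G_s] fails above level [m] with probability at most
    [2^(-m)], so a nonempty element depending on the sets [G_s], [s] in [l], has
    probability at least [1 - size l / 2^m] once [m] is large and the table agrees
    with one of its points on the finitely many relevant vertices. There are only
    countably many tables. The random colouring exists as an ultrafilter limit of
    finite ones. *)
Require Import Defs.
From Stdlib Require Import Reals.
From HB Require Import structures.
From mathcomp Require Import all_boot all_order all_algebra ring lra.
From mathcomp Require Import boolp classical_sets filter reals Rstruct topology.
From mathcomp Require Import normedtype Rstruct_topology.
Import Order.Theory GRing.Theory Num.Theory.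
Import numFieldNormedType.Exports.
Set Implicit Arguments. Unset Strict Implicit. Unset Printing Implicit Defensive.

Local Open Scope classical_set_scope.
Local Open Scope ring_scope.

(** * Averages over independent uniform colours *)

Section Averaging.
Context {K : realFieldType} {X : eqType} (N : X -> nat).
Hypothesis N_gt0 : forall x, (0 < N x)%N.
Implicit Types (w : X -> nat) (f g : (X -> nat) -> K) (V : seq X).

Definition update w (x : X) (c : nat) : X -> nat :=
  fun y => if y == x then c else w y.

Definition avg1 (x : X) f : (X -> nat) -> K :=
  fun w => (N x)%:R^-1 * \sum_(c < N x) f (update w x c).

(** Expectation when the colours on [V] are independent and uniform and the others are fixed. A
    repetition in [V] is harmless, as [avg1 x f] does not depend on the colour of [x]. *)
Fixpoint avg V f : (X -> nat) -> K :=
  if V is x :: V' then avg V' (avg1 x f) else f.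

Lemma avg1_cst x (r : K) : avg1 x (fun=> r) = fun=> r.
Proof.
apply/funext => w; rewrite /avg1 sumr_const card_ord -[r *+ _]mulr_natl.
rewrite mulrA mulVf ?mul1r//.
by rewrite pnatr_eq0 -lt0n.
Qed.

Lemma avg_cst V (r : K) : avg V (fun=> r) = fun=> r.
Proof. by elim: V => //= x V IH; rewrite avg1_cst. Qed.

(** Resampling changes colours on [V] only, so values off [V] can be taken from [w0]. *)
Lemma avg_le V f g w0 :
    (forall w, (forall y, y \notin V -> w y = w0 y) -> f w <= g w) ->
  avg V f w0 <= avg V g w0.
Proof.
elim: V f g => [|x V IH] f g fg /=; first exact: fg.
apply: IH => w wV; rewrite /avg1 ler_wpM2l ?invr_ge0 ?ler0n//.
apply: ler_sum => c _; apply: fg => y; rewrite inE negb_or /update.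
by case: eqP => //= _ /wV.
Qed.

Lemma avgD V f g w : avg V (fun z => f z + g z) w = avg V f w + avg V g w.
Proof.
elim: V f g => //= x V IH f g; rewrite -IH; congr (avg V _ w).
by apply/funext => z; rewrite /avg1 big_split mulrDr.
Qed.

Lemma avg_sum (T : Type) (s : seq T) V (F : T -> (X -> nat) -> K) w :
  avg V (fun z => \sum_(i <- s) F i z) w = \sum_(i <- s) avg V (F i) w.
Proof.
elim: s => [|i s IH].
  rewrite big_nil (_ : (fun=> _) = fun=> 0) ?avg_cst//.
  by apply/funext => z; rewrite big_nil.
rewrite big_cons -IH -avgD; congr (avg V _ w).
by apply/funext => z; rewrite big_cons.
Qed.

Lemma sum_modn_eq (n r : nat) : (0 < n)%N ->
  \sum_(c < n) (c %% n == r %% n)%N%:R = 1 :> K.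
Proof.
move=> n0; rewrite (bigD1 (Ordinal (ltn_pmod r n0)))//= modn_mod eqxx.
rewrite big1 ?addr0// => c; rewrite -val_eqE/= (modn_small (ltn_ord c)).
by move=> /negbTE->.
Qed.

(** Averaging over whichever of [x], [y] comes first in [V] already gives a constant: a colour
    running through all residues meets the other one exactly once. *)
Lemma avg_collision V (x y : X) w : x != y -> x \in V -> N x = N y ->
  avg V (fun z => (z x %% N x == z y %% N y)%N%:R) w = (N x)%:R^-1.
Proof.
move=> xy xV Nxy; elim: V xV => //= v V IH; rewrite inE.
have [<- _|xv /= xV] := eqVneq x v.
  rewrite (_ : avg1 _ _ = fun=> (N x)%:R^-1) ?avg_cst//; apply/funext => z.
  rewrite /avg1 /update eqxx eq_sym (negbTE xy) -Nxy.
  by rewrite sum_modn_eq ?mulr1.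
have [<-|yv] := eqVneq y v.
  rewrite (_ : avg1 _ _ = fun=> (N x)%:R^-1) ?avg_cst//; apply/funext => z.
  rewrite /avg1 /update eqxx (negbTE xy) Nxy.
  under eq_bigr do rewrite eq_sym.
  by rewrite sum_modn_eq ?mulr1.
rewrite (_ : avg1 _ _ = fun z => (z x %% N x == z y %% N y)%N%:R) ?IH//.
apply/funext => z; rewrite /avg1 /update (negbTE xv) (negbTE yv).
exact: (congr1 (@^~ z) (avg1_cst v _)).
Qed.

End Averaging.

Lemma sum_halves_le (K : realFieldType) (m n : nat) :
  \sum_(k <- iota m n) (2 ^ k.+1)%N%:R^-1 <= (2 ^ m)%N%:R^-1 :> K.
Proof.
elim: n m => [|n IH] m /=; first by rewrite big_nil invr_ge0 ler0n.
rewrite big_cons; apply: le_trans (lerD (lexx _) (IH _)) _.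
rewrite expnS natrM invfM.
set u : K := _^-1; lra.
Qed.

(** * Pairings, clashes and finite random colourings *)

Definition vertex : Type := ((nat -> bool) * nat)%type.
Definition pairing : Type := nat -> (nat -> bool) * (nat -> bool).
HB.instance Definition _ := Equality.on vertex.
HB.instance Definition _ := Equality.on pairing.

Definition colors (x : vertex) : nat := (2 ^ x.2.+1)%N.

(** The guard keeps a degenerate pair from clashing, so that every pairing has a clash-free
    colouring. *)
Definition clash (s : pairing) (k : nat) (z : vertex -> nat) : bool :=
  ((s k).1 != (s k).2) && (z ((s k).1, k) == z ((s k).2, k) %[mod 2 ^ k.+1]).

Lemma colors_gt0 x : (0 < colors x)%N.
Proof. by rewrite expn_gt0. Qed.

Section FiniteMeasure.
Variables (K : realFieldType) (u : vertex -> nat) (m : nat).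
Implicit Types (F l : seq pairing) (w : vertex -> nat) (a : set (vertex -> nat)).

Definition ends F (k : nat) : seq (nat -> bool) :=
  [seq (s k).1 | s <- F] ++ [seq (s k).2 | s <- F].

(* From level [m + 2 * size F] on there are at least as many colours as ends of
   pairs of [F], so these can be coloured injectively once and for all. *)
Definition base F (x : vertex) : nat :=
  if (x.2 < m)%N then u x else index x.1 (ends F x.2).

(** One uniform end per pair is enough to control the probability of a clash. *)
Definition random_vertices F : seq vertex :=
  [seq ((s k).1, k) | s <- F, k <- iota m (2 * size F)].

Definition fin_measure F a : K :=
  avg colors (random_vertices F) (fun w => `[< a w >]%:R) (base F).

Lemma fin_measure_ge0 F a : 0 <= fin_measure F a.
Proof.
rewrite -[X in X <= _](congr1 (@^~ (base F)) (avg_cst colors_gt0 (random_vertices F) _)).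
by apply: avg_le => w _; rewrite ler0n.
Qed.

Lemma fin_measureU F a b : a `&` b = set0 ->
  fin_measure F (a `|` b) = fin_measure F a + fin_measure F b.
Proof.
move=> ab; rewrite /fin_measure -avgD; congr (avg _ _ _ _).
apply/funext => w; rewrite asbool_or -natrD.
case: (asboolP (a w)) => [aw|_]; case: (asboolP (b w)) => //= bw.
by have : (a `&` b) w by []; rewrite ab.
Qed.

Lemma fin_measureT F : fin_measure F setT = 1.
Proof.
rewrite -[RHS](congr1 (@^~ (base F)) (avg_cst colors_gt0 (random_vertices F) _)).
by congr (avg _ _ _ _); apply/funext => w; rewrite asboolT.
Qed.

Lemma random_vertices_level F x : x \in random_vertices F ->
  (m <= x.2 < m + 2 * size F)%N.
Proof. by case/allpairsP=> -[s k] [_]; rewrite mem_iota => + ->. Qed.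

(** No vertex is random at level [k], and indices in [ends F k] are below
    [2 * size F <= k < 2 ^ k.+1], so distinct ends have distinct residues. *)
Lemma clash_base F w s k : s \in F -> (m + 2 * size F <= k)%N ->
  (forall x, x \notin random_vertices F -> w x = base F x) -> ~~ clash s k w.
Proof.
move=> sF Fk wE; rewrite /clash negb_and negbK; case: eqVneq => //= s12.
have out i : (i, k) \notin random_vertices F.
  by apply/negP => /random_vertices_level/=; rewrite ltnNge Fk andbF.
have mk : (k < m)%N = false by apply/negbTE; rewrite -leqNgt (leq_trans _ Fk)// leq_addr.
rewrite !wE// /base/= mk.
have e1 : (s k).1 \in ends F k.
  by rewrite mem_cat; apply/orP; left; apply/mapP; exists s.
have e2 : (s k).2 \in ends F k.
  by rewrite mem_cat; apply/orP; right; apply/mapP; exists s.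
have sz : size (ends F k) = (2 * size F)%N by rewrite size_cat !size_map mul2n addnn.
have small i : i \in ends F k -> (index i (ends F k) < 2 ^ k.+1)%N.
  rewrite -index_mem => /leq_trans; apply; rewrite sz.
  apply: (leq_trans (leq_trans (leq_addl m _) Fk)).
  by apply: ltnW; apply: (ltn_trans (ltnSn k)); rewrite ltn_expl.
rewrite !modn_small ?small//; apply: contraNneq s12 => e12.
by rewrite -(nth_index (s k).1 e1) e12 nth_index.
Qed.

Lemma avg_clash F s k w : s \in F -> (m <= k < m + 2 * size F)%N ->
  avg colors (random_vertices F) (fun z => (clash s k z)%:R) w
    <= (2 ^ k.+1)%N%:R^-1 :> K.
Proof.
move=> sF kF; have [s12|s12] := eqVneq (s k).1 (s k).2.
  rewrite (_ : (fun=> _) = fun=> 0) ?(avg_cst colors_gt0) ?invr_ge0 ?ler0n//.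
  by apply/funext => z; rewrite /clash s12 eqxx.
rewrite -(avg_collision (X := vertex) colors_gt0 (x := ((s k).1, k)) (y := ((s k).2, k))
  (V := random_vertices F) w)//.
- by apply: avg_le => z _; rewrite /clash s12.
- by apply: contraNneq s12 => -[->].
- by apply/allpairsP; exists (s, k); rewrite mem_iota.
Qed.

Lemma fin_measure_ge F l a : {subset l <= F} ->
    (forall w, (forall x, (x.2 < m)%N -> w x = u x) ->
       (forall s, s \in l -> forall k, (m <= k)%N -> ~~ clash s k w) -> a w) ->
  1 - (size l)%:R * (2 ^ m)%N%:R^-1 <= fin_measure F a.
Proof.
move=> lF la; pose ks := iota m (2 * size F).
pose bad (p : pairing * nat) (z : vertex -> nat) : K := (clash p.1 p.2 z)%:R.
pose ps := [seq (s, k) | s <- l, k <- ks].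
(* Pointwise, [1] is at most the indicator of [a] plus the number of clashes; this is averaged. *)
have badE : 1 <= fin_measure F a
    + \sum_(p <- ps) avg colors (random_vertices F) (bad p) (base F).
  rewrite -(avg_sum colors_gt0) /fin_measure -avgD.
  rewrite -[X in X <= _](congr1 (@^~ (base F)) (avg_cst colors_gt0 (random_vertices F) _)).
  apply: avg_le => w wE.
  have bad_ge0 (r : seq (pairing * nat)) : 0 <= \sum_(p <- r) bad p w.
    by apply: sumr_ge0 => p _; rewrite ler0n.
  have [aw|naw] := asboolP (a w); first by rewrite lerDl bad_ge0.
  suff [p pp cp] : exists2 p, p \in ps & clash p.1 p.2 w.
    rewrite add0r (perm_big _ (perm_to_rem pp)) big_cons.
    by rewrite /bad cp lerDl bad_ge0.
  apply: contra_notP naw => np; apply: la => [x xm|s sl k mk].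
    by rewrite wE/base ?xm//; apply/negP => /random_vertices_level; rewrite leqNgt xm.
  have [kF|Fk] := ltnP k (m + 2 * size F); last exact: (clash_base (lF _ sl)).
  apply/negP => cs; apply: np; exists (s, k) => //.
  by apply/allpairsP; exists (s, k); rewrite mem_iota mk kF.
rewrite lerBlDr; apply: le_trans badE _; rewrite lerD2l.
rewrite big_allpairs/= -sum1_size natr_sum mulr_suml big_seq [leRHS]big_seq.
apply: ler_sum => s sl; rewrite mul1r; apply: le_trans (sum_halves_le K m _).
rewrite big_seq [leRHS]big_seq; apply: ler_sum => k; rewrite mem_iota => kF.
by apply: avg_clash => //; apply: lF.
Qed.

End FiniteMeasure.

(** * Ultrafilter limits of measures *)

Section LimitMeasure.
Local Notation R := Rdefinitions.R.

Lemma ultra_bounded_cvg (T : Type) (G : set_system T) (f : T -> R) :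
    UltraFilter G -> (forall t, 0 <= f t <= 1) -> exists r : R, f @ G --> r.
Proof.
move=> GU f01; have [] := @segment_compact R 0 1 (f @ G) _ _.
  by apply: (@filterE _ G) => t /=; rewrite in_itv/= f01.
move=> r [_ rG]; exists r => A rA.
have [//|nA] := in_ultra_setVsetC (f @^-1` A) GU.
by have [x [nAx Ax]] := rG (~` A) A nA rA; case: (nAx Ax).
Qed.

(** All values lie in [[0, 1]], hence converge along an ultrafilter refining [E]; limits preserve
    sums and eventual lower bounds. *)
Lemma limit_measure (T Z : Type) (E : set_system T) (m : T -> set Z -> R) :
    ProperFilter E -> (forall t a, 0 <= m t a) ->
    (forall t a b, a `&` b = set0 -> m t (a `|` b) = m t a + m t b) ->
    (forall t, m t setT = 1) ->
  exists mu : set Z -> R,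
    [/\ forall a, 0 <= mu a,
        forall a b, a `&` b = set0 -> mu (a `|` b) = mu a + mu b,
        mu setT = 1 &
        forall a (r : R), (\forall t \near E, r <= m t a) -> r <= mu a].
Proof.
move=> PE m0 mU mT; have [G [GU EG]] := ultraFilterLemma PE.
have m01 t a : 0 <= m t a <= 1.
  rewrite m0 -(mT t) -(setUv a) mU ?setICr// lerDl; exact: m0.
have /choice[mu muP] : forall a, exists r : R, (m ^~ a) @ G --> r.
  move=> a; apply: (ultra_bounded_cvg GU) => t; exact: m01.
have muE a (r : R) : (m ^~ a) @ G --> r -> mu a = r.
  exact: (@cvg_unique R (@Rhausdorff R) _ _ _ _ (muP a)).
have mu_ge a (r : R) : (\forall t \near E, r <= m t a) -> r <= mu a.
  move=> ra; rewrite -(cvg_lim (@Rhausdorff R) (muP a)).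
  by apply: limr_ge; [apply/cvg_ex; exists (mu a); exact: muP|exact: EG].
exists mu; split=> //.
- by move=> a; apply: mu_ge; apply: nearW => t; exact: m0.
- move=> a b ab; apply: muE.
  rewrite (_ : m ^~ (a `|` b) = (m ^~ a) \+ (m ^~ b)).
    exact: (@cvgD R R^o _ _ _ _ _ _ _ (muP a) (muP b)).
  by apply/funext => t; apply: mU.
- apply: muE; rewrite (_ : m ^~ setT = fun=> 1); first exact: cvg_cst.
  by apply/funext => t; apply: mT.
Qed.

Lemma random_measure (u : vertex -> nat) (m : nat) :
  exists mu : set (vertex -> nat) -> R,
    [/\ forall a, 0 <= mu a,
        forall a b, a `&` b = set0 -> mu (a `|` b) = mu a + mu b,
        mu setT = 1 &
        forall (l : seq pairing) (a : set (vertex -> nat)),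
          (forall w, (forall x, (x.2 < m)%N -> w x = u x) ->
             (forall s, s \in l -> forall k, (m <= k)%N -> ~~ clash s k w) ->
             a w) ->
          1 - (size l)%:R * (2 ^ m)%N%:R^-1 <= mu a].
Proof.
(* Eventually along [E], the list [F] contains any given finite list [l]. *)
pose E : set_system (seq pairing) :=
  fun P => exists l : seq pairing, forall F : seq pairing, {subset l <= F} -> P F.
have PE : ProperFilter E.
  split; first by case=> l /(_ l); apply.
  split; first by exists [::].
  - move=> P Q [l lP] [k kQ]; exists (l ++ k) => F lkF; split.
      by apply: lP => s sl; apply: lkF; rewrite mem_cat sl.
    by apply: kQ => s sl; apply: lkF; rewrite mem_cat sl orbT.
  - by move=> P Q PQ [l lP]; exists l => F /lP/PQ.
have [|||mu [mu0 muU muT muE]] := @limit_measure _ _ E (fin_measure R u m) PE.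
- exact: fin_measure_ge0.
- exact: fin_measureU.
- exact: fin_measureT.
exists mu; split => // l a la; apply: muE; exists l => F lF.
exact: fin_measure_ge la.
Qed.

End LimitMeasure.

(** * The Boolean algebra of determined sets *)

Definition proper_coloring (s : pairing) : set (vertex -> nat) :=
  [set z | forall k, ~~ clash s k z].

(* All Boolean combinations of coordinate sets and sets [proper_coloring s]
   satisfy this, and it is visibly stable under the Boolean operations. *)
Definition determined (a : set (vertex -> nat)) : Prop :=
  exists (A : seq vertex) (l : seq pairing), forall z w,
    (forall x, x \in A -> z x = w x) ->
    (forall s, s \in l -> (proper_coloring s z <-> proper_coloring s w)) ->
    a z -> a w.

Lemma determinedI a b : determined a -> determined b -> determined (a `&` b).
Proof.
move=> [A [l al]] [A' [l' bl]]; exists (A ++ A'), (l ++ l') => z w zA zl [az bz].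
split; [apply: al az|apply: bl bz] => x xA.
- by apply: zA; rewrite mem_cat xA.
- by apply: zl; rewrite mem_cat xA.
- by apply: zA; rewrite mem_cat xA orbT.
- by apply: zl; rewrite mem_cat xA orbT.
Qed.

Lemma determinedC a : determined a -> determined (~` a).
Proof.
move=> [A [l al]]; exists A, l => z w zA zl naz aw; apply: naz.
by apply: al aw => [x /zA|s /zl []]; [|split].
Qed.

Lemma determinedU a b : determined a -> determined b -> determined (a `|` b).
Proof.
by move=> /determinedC aC /determinedC bC; rewrite -[_ `|` _]setCK setCU;
  apply/determinedC/determinedI.
Qed.

Lemma determined0 : determined set0.
Proof. by exists [::], [::]. Qed.

Lemma determinedT : determined setT.
Proof. by exists [::], [::]. Qed.

Lemma determined_proper s : determined (proper_coloring s).
Proof. by exists [::], [:: s] => z w _ /(_ s); rewrite inE eqxx => -[]. Qed.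

Lemma determined_preimage (x : vertex) (Q : set nat) :
  determined [set z | Q (z x)].
Proof. by exists [:: x], [::] => z w /(_ x)/=; rewrite inE eqxx => ->. Qed.

Definition determinedb : {pred set (vertex -> nat)} := fun a => `[< determined a >].

Record coloring_algebra := ColoringAlgebra
  { colorings :> set (vertex -> nat); _ : colorings \in determinedb }.

HB.instance Definition _ := [isSub for colorings].
HB.instance Definition _ := [Choice of coloring_algebra by <:].

Fact determinedb_meet :
  {in determinedb &, forall a b : set (vertex -> nat), (a `&` b)%O \in determinedb}.
Proof. by move=> a b /asboolP da /asboolP db; apply/asboolP/determinedI. Qed.
Fact determinedb_join :
  {in determinedb &, forall a b : set (vertex -> nat), (a `|` b)%O \in determinedb}.
Proof. by move=> a b /asboolP da /asboolP db; apply/asboolP/determinedU. Qed.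
Fact determinedb_bot : (\bot : set (vertex -> nat))%O \in determinedb.
Proof. exact/asboolP/determined0. Qed.
Fact determinedb_top : (\top : set (vertex -> nat))%O \in determinedb.
Proof. exact/asboolP/determinedT. Qed.

HB.instance Definition _ := Order.SubChoice_isTBSubLattice.Build
  set_display (set (vertex -> nat)) determinedb set_display coloring_algebra
  determinedb_meet determinedb_join determinedb_bot determinedb_top.

Fact coloring_meetUl : @left_distributive coloring_algebra _ Order.meet Order.join.
Proof. by move=> a b c; apply: val_inj; exact: (@setIUl _ (val a) (val b) (val c)). Qed.

HB.instance Definition _ := Order.Lattice_Meet_isDistrLattice.Build
  set_display coloring_algebra coloring_meetUl.

Fact coloring_compl_subproof (a : coloring_algebra) : ~` val a \in determinedb.
Proof. by case: a => a /= /asboolP da; apply/asboolP/determinedC. Qed.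

Definition coloring_compl a := ColoringAlgebra (coloring_compl_subproof a).

Fact coloring_joinxC a : (a `|` coloring_compl a)%O = \top%O.
Proof. by apply: val_inj; exact: setUCr. Qed.
Fact coloring_meetxC a : (a `&` coloring_compl a)%O = \bot%O.
Proof. by apply: val_inj; exact: setICr. Qed.

HB.instance Definition _ := Order.TBDistrLattice_hasComplement.Build
  set_display coloring_algebra coloring_joinxC coloring_meetxC.


(** * Monotonicity and finite subadditivity *)

Section FiniteAdditivity.
Context {d : Order.disp_t} {B : ctbDistrLatticeType d} (mu : B -> Rdefinitions.R).
Hypothesis mu_fa : fa_measure mu.
Local Open Scope order_scope.

Lemma fa_ge0 a : (0 <= mu a)%R.
Proof. by apply/RleP; case: mu_fa. Qed.

Lemma faU a b : a `&` b = \bot -> mu (a `|` b) = (mu a + mu b)%R.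
Proof. by case: mu_fa => _; apply. Qed.

Lemma fa_le a b : a <= b -> (mu a <= mu b)%R.
Proof.
move=> /meet_idPr ba; rewrite -(joinIB a b) faU; last exact: meetIB.
by rewrite ba lerDl fa_ge0.
Qed.

Lemma fa_joins_le (I : finType) (F : I -> B) a :
  a <= \join_i F i -> (mu a <= \sum_i mu (F i))%R.
Proof.
move/fa_le/le_trans; apply; apply: (big_ind2 (fun x y => (mu x <= y)%R)) => //.
  (* [\bot] is disjoint from itself, so its measure is [0]. *)
  have := faU (meetxx (\bot : B)); rewrite joinxx => /eqP.
  by rewrite -subr_eq0 opprD addrA subrr sub0r oppr_eq0 => /eqP->.
move=> x r y q xr yq; apply: (le_trans _ (lerD xr yq)).
rewrite -(joinIB x (x `|` y)) faU; last exact: meetIB.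
by rewrite (meet_idPr (leUl x y)) joinBKC lerD2l fa_le// leBx.
Qed.

End FiniteAdditivity.

(** * No strictly positive separable measure *)

Lemma cantor_noninjective (T : countType) (g : (nat -> bool) -> T) :
  exists i j, i != j /\ g i = g j.
Proof.
apply: contrapT => inj.
have g_inj i j : g i = g j -> i = j.
  by move=> gij; apply/eqP/negP => /negP ij; apply: inj; exists i, j.
pose diag n := `[< exists2 i, pickle (g i) = n & i n = false >].
have : diag (pickle (g diag)) = ~~ diag (pickle (g diag)).
  apply/asboolP/negP => [[i /(pcan_inj pickleK)/g_inj -> ->]//|dg].
  by exists diag => //; apply/negP.
by case: (diag _).
Qed.

Lemma coloring_leP (a b : coloring_algebra) :
  reflect (val a `<=` val b) (a <= b)%O.
Proof.
rewrite leEmeet; apply: (iffP eqP) => [/(congr1 val)/setIidPl//|ab].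
by apply: val_inj; apply/setIidPl.
Qed.

Lemma determinedb_preimage (x : vertex) (Q : set nat) :
  [set z | Q (z x)] \in determinedb.
Proof. exact/asboolP/determined_preimage. Qed.

Lemma determinedb_proper s : proper_coloring s \in determinedb.
Proof. exact/asboolP/determined_proper. Qed.

Definition color_class (i : nat -> bool) (k c : nat) : coloring_algebra :=
  ColoringAlgebra (determinedb_preimage (i, k) [set n | (n %% 2 ^ k.+1)%N = c]).

Definition proper_elt (s : pairing) : coloring_algebra :=
  ColoringAlgebra (determinedb_proper s).

(** A proper colouring lies in the difference indexed by the residue [c] of the first end. *)
Lemma proper_elt_le s k : (s k).1 != (s k).2 ->
  (proper_elt s <= \join_(c < 2 ^ k.+1)
     (color_class (s k).1 k c `\` color_class (s k).2 k c))%O.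
Proof.
move=> s12; apply/coloring_leP => z /(_ k); rewrite /clash s12/= => zk.
have k0 : (0 < 2 ^ k.+1)%N by rewrite expn_gt0.
pose c := Ordinal (ltn_pmod (z ((s k).1, k)) k0).
have /coloring_leP := joins_sup (fun c : 'I__ =>
  color_class (s k).1 k c `\` color_class (s k).2 k c)%O (erefl (xpredT c)).
apply; split => //= e; by rewrite e eqxx in zk.
Qed.

Lemma proper_elt_neq0 s : proper_elt s <> \bot%O.
Proof.
move=> /(congr1 val)/= s0.
(* Colour [1] on the first end of each pair and [0] elsewhere: distinct residues, as the modulus is
   at least [2]. *)
suff : proper_coloring s (fun x => x.1 == (s x.2).1).
  by rewrite s0.
move=> k; rewrite /clash/=; case: eqVneq => //= s12.
by rewrite eqxx mod0n modn_small// (@leq_trans (2 ^ 1))// leq_exp2l.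
Qed.

(** Each [i] gets a tuple of indices of dense elements close to its colour classes. Tuples are
    countably many, so some [i != j] share one. *)
Lemma separable_small_pair (mu : coloring_algebra -> Rdefinitions.R) (k : nat) :
    fa_measure mu -> separable_measure mu ->
  exists p : (nat -> bool) * (nat -> bool),
    forall s : pairing, s k = p -> mu (proper_elt s) <= k.+1%:R^-1.
Proof.
move=> mu_fa [D Dmu]; pose n := (2 ^ k.+1)%N.
have n0 : 0 < n%:R :> Rdefinitions.R by rewrite ltr0n expn_gt0.
(* Chosen so that [n] errors of [2 * e] add up to [k.+1%:R^-1]. *)
pose e : Rdefinitions.R := (n%:R * 2 * k.+1%:R)^-1.
have e0 : 0 < e by rewrite invr_gt0 !mulr_gt0.
have /choice[g gP] (i : nat -> bool) : exists g : {ffun 'I_n -> nat},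
    forall c : 'I_n, mu (symdiff (color_class i k c) (D (g c))) < e.
  have /choice[g gP] (c : 'I_n) : exists m, mu (symdiff (color_class i k c) (D m)) < e.
    have [m /RltP mP] := Dmu (color_class i k c) e (elimT RltP e0).
    by exists m.
  by exists (finfun g) => c; rewrite ffunE.
have [i [j [ij gij]]] := cantor_noninjective g.
exists (i, j) => s sk; have := @proper_elt_le s k; rewrite sk => /(_ ij).
move=> /(fa_joins_le mu_fa)/le_trans; apply; rewrite /= -/n.
apply: (@le_trans _ _ (\sum_(c < n) (e + e))); last first.
  rewrite sumr_const card_ord -[_ *+ n]mulr_natl /e.
  rewrite le_eqVlt; apply/orP; left; apply/eqP.
  by field; rewrite nat1r !gt_eqF//.
apply: ler_sum => c _; apply: (le_trans _ (lerD (ltW (gP i c)) (ltW (gP j c)))).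
rewrite -gij; set x := color_class i k c; set y := color_class j k c.
(* The difference of [x] and [y] is covered by their symmetric differences with the common
   approximant. *)
pose F (b : bool) := symdiff (if b then x else y) (D (g i c)).
have := @fa_joins_le _ _ _ mu_fa _ F (x `\` y)%O; rewrite !big_bool/=; apply.
apply/coloring_leP => z /= [xz nyz].
have [Dz|nDz] := pselect (val (D (g i c)) z).
  by right; right; split.
by left; left; split.
Qed.

Lemma no_separable_measure :
  ~ exists mu : coloring_algebra -> Rdefinitions.R,
      fa_measure mu /\ strictly_positive mu /\ separable_measure mu.
Proof.
move=> [mu [mu_fa [mu_pos mu_sep]]].
have /choice[s sP] k := separable_small_pair k mu_fa mu_sep.
have /RltP := mu_pos _ (@proper_elt_neq0 s).
apply/negP; rewrite -leNgt; apply/ler_addgt0Pr => e e0; rewrite add0r.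
have [k ke] : exists k, k.+1%:R^-1 < e.
  exists (Num.truncn e^-1); rewrite invf_plt ?posrE// truncnS_gt//.
exact: le_trans (sP k s erefl) (ltW ke).
Qed.


(** * Countably many tables and approximability *)

(** Table entries are a prefix of length [L], a level and a colour; a vertex missing from [t] gets
    colour [0]. *)
Definition lookup (t : seq (seq bool * nat * nat)) (L : nat) (x : vertex) : nat :=
  nth 0%N (unzip2 t) (index (mkseq x.1 L, x.2) (unzip1 t)).

(** Distinct sequences differ at some position; [L] exceeds one such position for every pair from
    [A]. *)
Lemma prefixes_separate (A : seq (nat -> bool)) :
  exists L, {in A &, injective (fun i => mkseq i L)}.
Proof.
have /choice[d dP] (p : (nat -> bool) * (nat -> bool)) :
    exists n, p.1 n = p.2 n -> p.1 = p.2.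
  apply: contrapT => /forallNP np; suff e : p.1 = p.2 by apply: (np 0%N).
  by apply/funext => n; apply: contrapT => pn; apply: (np n).
exists (\max_(p <- [seq (i, j) | i <- A, j <- A]) d p).+1 => i j iA jA ij.
apply: (dP (i, j)) => /=; set n := d _.
have nL : (n < (\max_(p <- [seq (i, j) | i <- A, j <- A]) d p).+1)%N.
  by rewrite ltnS; apply: leq_bigmax_seq => //; apply/allpairsP; exists (i, j).
by rewrite -(nth_mkseq false i nL) ij nth_mkseq.
Qed.

Lemma lookup_onto (A : seq vertex) (z : vertex -> nat) :
  exists t L, {in A, lookup t L =1 z}.
Proof.
have [L LP] := prefixes_separate [seq x.1 | x <- A].
pose key (x : vertex) := (mkseq x.1 L, x.2).
have key_inj : {in A &, injective key}.
  move=> [i k] [j l] iA jA [ij ->]; congr pair.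
  by apply: LP ij; [exact: (map_f fst iA)|exact: (map_f fst jA)].
exists [seq (key x, z x) | x <- A], L => x xA.
rewrite /lookup /unzip1 /unzip2 -!map_comp -/(key x) (eq_map (g := key))//.
rewrite (nth_map x) ?nth_index_map//.
by rewrite -(size_map key A) index_mem map_f.
Qed.

Lemma coloring_algebra_approximable : approximable coloring_algebra.
Proof.
have /choice[nu nuP] := fun p : (vertex -> nat) * nat => random_measure p.1 p.2.
pose mus (n : nat) (a : coloring_algebra) :=
  let: (t, L, m) := odflt ([::], 0%N, 0%N) (unpickle n) in nu (lookup t L, m) (val a).
exists mus; split.
  move=> n; rewrite /mus; case: (odflt _ _) => [[t L] m].
  have [nu0 nuU nuT _] := nuP (lookup t L, m).
  split=> //; split=> [a|a b ab]; first exact/RleP.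
  exact: nuU (congr1 val ab).
move=> a a0; have [z az] : val a !=set0.
  by apply/set0P/eqP => e; apply: a0; apply: val_inj.
have [A [l al]] : determined (val a) by case: (a) => a' /= /asboolP.
(* [bad s] is a level where [z] clashes, or the dummy [0] if [z] is proper for [s]. *)
have /choice[bad badP] (s : pairing) : exists k, proper_coloring s z \/ clash s k z.
  have [sz|nsz] := pselect (proper_coloring s z); first by exists 0%N; left.
  have /existsNP[k /negP] := nsz; rewrite negbK => sk.
  by exists k; right.
(* Above all levels of [A] and all bad levels, and at least [size l + 2], so that
   [4 * size l <= 2 ^ m] and the measure is at least [3/4]. *)
pose m := (\max_(s <- l) bad s + \max_(x <- A) x.2 + size l).+2.
have A_lt_m x : x \in A -> (x.2 < m)%N.
  move=> xA; rewrite ltnS (leq_trans (leq_bigmax_seq (F := snd) x xA isT))//.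
  by rewrite ltnW// ltnS -addnA addnCA leq_addr.
have bad_lt_m s : s \in l -> (bad s < m)%N.
  move=> sl; rewrite ltnS (leq_trans (leq_bigmax_seq (F := bad) s sl isT))//.
  by rewrite ltnW// ltnS -addnA leq_addr.
(* Both ends of the pairs below level [m] are added, so that clashes there are the same for [w] and
   [z]. *)
pose A' := A ++ ([seq ((s k).1, k) | s <- l, k <- iota 0 m]
              ++ [seq ((s k).2, k) | s <- l, k <- iota 0 m]).
have [t [L tL]] := lookup_onto A' z.
exists (pickle (t, L, m)); rewrite /mus pickleK/=.
have [_ _ _ nu_ge] := nuP (lookup t L, m); apply/RltP.
apply: (lt_le_trans _ (nu_ge l (val a) _)) => /=.
  have lm : (2 * (2 * size l) <= 2 ^ m)%N.
    rewrite !expnS !leq_mul2l/=.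
    exact: ltnW (leq_ltn_trans (leq_addl _ _) (ltn_expl _ (ltnSn 1))).
  have : (2 * (2 * size l))%:R <= (2 ^ m)%:R :> Rdefinitions.R by rewrite ler_nat.
  have : 0 < (2 ^ m)%:R :> Rdefinitions.R by rewrite ltr0n expn_gt0.
  set q : Rdefinitions.R := (2 ^ m)%:R => q0; rewrite !natrM => lq.
  have : (size l)%:R * q^-1 <= 4^-1 by rewrite ler_pdivrMr//; lra.
  by rewrite RinvE (_ : Rdefinitions.IZR 2 = 2%:R :> Rdefinitions.R)//; lra.
move=> w wt wl; apply: al az => [x xA|s sl].
  by rewrite wt ?A_lt_m// tL// mem_cat xA.
have clash_eq k : (k < m)%N -> clash s k w = clash s k z.
  move=> km; rewrite /clash !wt//= !tL// !mem_cat; apply/orP; right; apply/orP.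
    by right; apply/allpairsP; exists (s, k); rewrite mem_iota.
  by left; apply/allpairsP; exists (s, k); rewrite mem_iota.
split=> [sz k|sw].
  by have [/clash_eq ->|/(wl s sl)] := ltnP k m.
by have [//|] := badP s; rewrite -clash_eq ?bad_lt_m// (negbTE (sw _)).
Qed.

Theorem theorem4p4 :
  exists (d : Order.disp_t) (B : ctbDistrLatticeType d),
    approximable B /\
    ~ (exists mu : B -> R,
         fa_measure mu /\ strictly_positive mu /\ separable_measure mu).
Proof.
exists set_display, coloring_algebra.
by split; [exact: coloring_algebra_approximable|exact: no_separable_measure].
Qed.
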